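(* For every integer $t \geq 3$ there is a constant $c>0$ such that for every positive integer $n$, \[\overline{R}(\mathcal{K}^{(3)}_{t+1},\mathcal{K}^{(3)}_3(n)) \geq 2^{c\, n \log{n}}.\]
   Context: Ordered $3$-uniform hypergraphs are $3$-uniform hypergraphs with a linear ordering of their vertex sets; copies must preserve the orderings. $\mathcal{K}^{(3)}_{m}$ is the ordered complete $3$-uniform hypergraph on $m$ vertices. $\mathcal{K}^{(3)}_3(n)$ is the ordered complete $3$-uniform tripartite hypergraph whose vertex set consists of three consecutive intervals of $n$ vertices each, with hyperedges exactly the triples having one vertex in each interval. $\overline{R}(\mathcal{H},\mathcal{G})$ is the smallest $N$ such that every red-blue coloring of the hyperedges of $\mathcal{K}^{(3)}_N$ contains a blue ordered copy of $\mathcal{H}$ or a red ordered copy of $\mathcal{G}$. $\log$ is base $2$. *)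

(* Defs.v *)
(* Library: MathComp, with MathComp-Analysis for the real exponential and
   logarithm. *)
From HB Require Import structures.
From mathcomp Require Import all_boot all_order all_algebra.
From mathcomp Require Import reals exp.

Set Implicit Arguments.
Unset Strict Implicit.
Unset Printing Implicit Defensive.

Import Order.TTheory GRing.Theory Num.Theory.

(* A finite linearly ordered vertex set is represented by 'I_m with the order
   of the natural numbers, to which it is uniquely isomorphic. *)
Record ohgraph3 := OHGraph3 {
  nverts : nat;
  edges : {set {set 'I_nverts}};
  edges_uniform : forall e, e \in edges -> #|e| = 3
}.

Lemma complete3_uniform m :
  forall e, e \in [set e : {set 'I_m} | #|e| == 3] -> #|e| = 3.
Proof. by move=> e; rewrite inE => /eqP. Qed.

Definition complete3 (m : nat) : ohgraph3 := OHGraph3 (@complete3_uniform m).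

Definition part_interval (n : nat) (k : 'I_3) : {set 'I_(3 * n)} :=
  [set v : 'I_(3 * n) | k * n <= v < k.+1 * n].

Definition tripartite3_edges (n : nat) : {set {set 'I_(3 * n)}} :=
  [set e in edges (complete3 (3 * n)) |
    [forall k : 'I_3, #|e :&: part_interval n k| == 1]].

Lemma tripartite3_uniform n :
  forall e, e \in tripartite3_edges n -> #|e| = 3.
Proof. by move=> e; rewrite !inE => /andP[/eqP]. Qed.

Definition tripartite3 (n : nat) : ohgraph3 := OHGraph3 (@tripartite3_uniform n).

(* [contains_copy G H]: G contains an ordered (not necessarily induced) copy
   of H. *)
Definition contains_copy (G H : ohgraph3) : bool :=
  [exists f : {ffun 'I_(nverts H) -> 'I_(nverts G)},
    [forall i : 'I_(nverts H), forall j : 'I_(nverts H),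
      (i < j) ==> (f i < f j)] &&
    [forall e in edges H, f @: e \in edges G]].

Inductive colour := Red | Blue.

Definition bool_of_colour (c : colour) : bool := if c is Blue then true else false.
Definition colour_of_bool (b : bool) : colour := if b then Blue else Red.
Lemma bool_of_colourK : cancel bool_of_colour colour_of_bool.
Proof. by case. Qed.

HB.instance Definition _ := Finite.copy colour (can_type bool_of_colourK).

(* A colouring is a function on all vertex sets, but only its values on the
   hyperedges of the complete hypergraph matter. *)
Definition colouring (N : nat) := {ffun {set 'I_N} -> colour}.

Lemma colour_class_uniform N (chi : colouring N) (b : colour) :
  forall e, e \in [set e in edges (complete3 N) | chi e == b] -> #|e| = 3.
Proof. by move=> e; rewrite !inE => /andP[/eqP]. Qed.

Definition colour_class N (chi : colouring N) (b : colour) : ohgraph3 :=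
  OHGraph3 (@colour_class_uniform N chi b).

Definition arrows (N : nat) (H G : ohgraph3) : bool :=
  [forall chi : colouring N,
    contains_copy (colour_class chi Blue) H ||
    contains_copy (colour_class chi Red) G].

(* Ramsey's theorem, needed for the ordered Ramsey number to be defined; the
   r-subsets are the length-r subsequences of a sequence. *)
Lemma ramsey_seq (r m : nat) : exists N, forall (T : eqType)
    (c : seq T -> bool) (s : seq T), N <= size s ->
  exists (b : bool) (s' : seq T), [/\ subseq s' s, size s' = m &
    forall t, subseq t s' -> size t = r -> c t = b].
Proof.
elim: r m => [|r IHr] m.
  exists m => T c s ms; exists (c [::]), (take m s); split.
  - exact: take_subseq.
  - by rewrite size_take_min; apply/minn_idPl.
  - by move=> t _ /size0nil ->.
have H k : exists N, forall (T : eqType) (c : seq T -> bool) (s : seq T),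
    N <= size s -> exists (d : T -> bool) (s' : seq T),
      [/\ subseq s' s, size s' = k & forall x t,
          subseq (x :: t) s' -> size t = r -> c (x :: t) = d x].
  elim: k => [|k [N IHk]].
    by exists 0 => T c s _; exists xpred0, [::]; split=> //; exact: sub0seq.
  have [M HM] := IHr N; exists M.+1 => T c [//|x s] /= Ms.
  have [b [s2 [s2s sz2 hom2]]] := HM T (fun t => c (x :: t)) s Ms.
  have [|d [s3 [s3s2 sz3 hom3]]] := IHk T c s2; first by rewrite sz2.
  exists (fun y => if y == x then b else d y), (x :: s3); split.
  - by rewrite /= eqxx; exact: subseq_trans s3s2 s2s.
  - by rewrite /= sz3.
  - move=> y t /=; case: eqVneq => [-> ts3 szt|yx yts3 szt].
      by apply: hom2 => //; exact: subseq_trans ts3 s3s2.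
    exact: hom3.
have [N HN] := H (m + m); exists N => T c s Ns.
have [d [s' [s's sz hom]]] := HN T c s Ns.
have [b mb] : exists b, m <= size (filter (fun x => d x == b) s').
  have := count_predC (fun x => d x == true) s'; rewrite sz => E.
  have [le|lt] := leqP m (count (fun x => d x == true) s').
    by exists true; rewrite size_filter.
  exists false; rewrite size_filter.
  rewrite (eq_count (a2 := predC (fun x => d x == true))); last first.
    by move=> x /=; case: (d x).
  by rewrite -(leq_add2l m) -E leq_add2r ltnW.
have sub : subseq (take m (filter (fun x => d x == b) s'))
                  (filter (fun x => d x == b) s') by exact: take_subseq.
exists b, (take m (filter (fun x => d x == b) s')); split.
- apply: subseq_trans sub (subseq_trans _ s's); exact: filter_subseq.
- by rewrite size_take_min; apply/minn_idPl.
- move=> [//|x t] xt [szt].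
  have xf := subseq_trans xt sub.
  have : x \in filter (fun x => d x == b) s'.
    by apply: (mem_subseq xf); rewrite mem_head.
  rewrite mem_filter => /andP[/eqP <- _]; apply: hom => //.
  by apply: subseq_trans xf _; exact: filter_subseq.
Qed.

Lemma contains_copy_subseq N (chi : colouring N) (b : colour) (H : ohgraph3)
    (s : seq 'I_N) :
  subseq s (enum 'I_N) -> nverts H <= size s ->
  (forall t, subseq t s -> size t = 3 -> chi [set x in t] = b) ->
  contains_copy (colour_class chi b) H.
Proof.
move=> sN Hs hom.
case: N => [|N] in chi s sN Hs hom *.
  case: s sN Hs {hom} => [_ /= H0|[]//].
  case: H H0 => [[|//] E U _]; apply/existsP.
  exists [ffun i => i]; apply/andP; split; first by apply/forallP => -[].
  apply/forall_inP => e eE; have := U e eE.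
  by have := max_card (mem e); rewrite card_ord leqn0 => /eqP ->.
have srt : sorted ltn (map val s).
  apply: (subseq_sorted ltn_trans (map_subseq val sN)).
  by rewrite val_enum_ord iota_ltn_sorted.
pose f := [ffun i : 'I_(nverts H) => nth (@ord0 N) s i].
have fmono (i j : 'I_(nverts H)) : i < j -> f i < f j.
  move=> ij; rewrite !ffunE.
  have js : j < size s := leq_trans (ltn_ord j) Hs.
  have is_ : i < size s := ltn_trans ij js.
  rewrite -!(nth_map _ 0 val) //.
  by apply: (sorted_ltn_nth ltn_trans) => //; rewrite inE size_map.
have finj : injective f.
  move=> i j fij; apply/val_inj; have [ij|ij|//] := ltngtP (val i) (val j).
    by have := fmono _ _ ij; rewrite fij ltnn.
  by have := fmono _ _ ij; rewrite fij ltnn.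
have fs : map f (enum 'I_(nverts H)) = take (nverts H) s.
  apply: (@eq_from_nth _ ord0).
    by rewrite size_map size_enum_ord size_take_min; apply/esym/minn_idPl.
  move=> i; rewrite size_map size_enum_ord => iH.
  rewrite (nth_map (Ordinal iH)) ?size_enum_ord // ffunE nth_take //.
  by rewrite nth_enum_ord.
apply/existsP; exists f; apply/andP; split.
  by apply/forallP => i; apply/forallP => j; apply/implyP; exact: fmono.
apply/forall_inP => e eE.
have e3 := edges_uniform eE.
have -> : f @: e = [set x in map f (enum e)].
  by apply/setP => x; rewrite inE; apply/imsetP/mapP => -[y ye ->];
     exists y => //; move: ye; rewrite mem_enum.
rewrite !inE; apply/andP; split.
  rewrite cardsE; apply/eqP.
  have /card_uniqP -> : uniq (map f (enum e)) by rewrite map_inj_uniq ?enum_uniq.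
  by rewrite size_map -cardE.
apply/eqP; apply: hom; last by rewrite size_map -cardE.
apply: (@subseq_trans _ (take (nverts H) s)); last exact: take_subseq.
rewrite -fs; apply: map_subseq.
have -> : enum e = filter (mem e) (enum 'I_(nverts H)).
  by rewrite /enum_mem -filter_predI; apply: eq_filter => x /=; rewrite andbT.
exact: filter_subseq.
Qed.

Lemma ordered_ramsey_exists (H G : ohgraph3) : exists N, arrows N H G.
Proof.
have [N HN] := ramsey_seq 3 (maxn (nverts H) (nverts G)).
exists N; apply/forallP => chi.
have [|b [s [sN szs hom]]] :=
    HN _ (fun t => bool_of_colour (chi [set x in t])) (enum 'I_N).
  by rewrite size_enum_ord.
have {}hom t : subseq t s -> size t = 3 ->
    chi [set x in t] = colour_of_bool b.
  by move=> ts /(hom _ ts) <-; rewrite bool_of_colourK.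
case: b hom => hom; apply/orP; [left|right];
  apply: (contains_copy_subseq sN _ hom); rewrite szs.
- exact: leq_maxl.
- exact: leq_maxr.
Qed.

Definition ordered_ramsey (H G : ohgraph3) : nat :=
  ex_minn (ordered_ramsey_exists H G).

Definition log2 {R : realType} (x : R) : R := (ln x / ln 2)%R.

(* Main.v *)
Require Import Defs.
From mathcomp Require Import all_boot all_order all_algebra all_field.
From mathcomp Require Import reals exp.
From mathcomp Require Import ring lra zify.

(** Let [F] be a finite field with [q] elements and let the colours be the
    [q ^ 3] flags (point on a non-vertical line) of its affine plane. Put an arc
    from the flag [(P, l)] to [(P', l')] when [P'] lies on [l], [l] and [l'] have
    different slopes, and [P] and [P'] have different abscissas. Two lines with
    different slopes share only one point, so there is no transitive triangle,
    while a second moment argument yields an arc from [S] to [T] as soon as [S]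
    and [T] have about [q ^ (5 / 2)] elements.

    Give every ordered pair of vertices a random flag, and colour a triple
    [a < b < c] blue when there is an arc from the flag of [(a, b)] to that of
    [(a, c)]. A blue [K_4] would contain a transitive triangle of arcs. In a red
    copy with parts [A < B < C], every [a] in [A] sees fewer than about
    [q ^ (5 / 2)] flags on [B] or on [C]; with [q ^ (5 / 2)] a small multiple of
    [n], this has probability [q ^ (- Omega(n))] for a single [a], hence
    [n ^ (- Omega(n ^ 2))] for half of [A], which beats the [N ^ (2 * n)] choices
    of vertices when [N = n ^ (c * n)]. *)

Set Implicit Arguments.
Unset Strict Implicit.
Unset Printing Implicit Defensive.

Import Order.TTheory GRing.Theory Num.Theory.

(** * Counting rows that take few values *)

Lemma leq_card_bigcup (I T : finType) (P : pred I) (F : I -> {set T}) :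
  #|\bigcup_(i | P i) F i| <= \sum_(i | P i) #|F i|.
Proof.
elim/big_rec2: _ => [|i n U _ leUn]; first by rewrite cards0.
by rewrite (leq_trans (leq_card_setU _ _)) // leq_add2l.
Qed.

Lemma leq_bin_exp n m : 'C(n, m) <= n ^ m.
Proof.
elim: m => [|m IH]; first by rewrite bin0.
rewrite expnS; have := mul_bin_left n m; have := IH; nia.
Qed.

Lemma leq_wexp2r e m n : m <= n -> m ^ e <= n ^ e.
Proof. by case: e => [|e] // le_mn; rewrite leq_exp2r. Qed.

Lemma card_ffun_in (aT rT : finType) (A : {set aT}) (P : {set rT}) :
  #|[set f : {ffun aT -> rT} | [forall x in A, f x \in P]]|
    = #|P| ^ #|A| * #|rT| ^ (#|aT| - #|A|).
Proof.
pose D x := [pred y | (x \in A) ==> (y \in P)].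
have -> : #|[set f : {ffun aT -> rT} | [forall x in A, f x \in P]]|
   = #|family D : simpl_pred {ffun aT -> rT}|.
  by rewrite cardsE; apply: eq_card.
rewrite card_family foldrE big_map big_enum /= (bigID (mem A)) /=.
congr (_ * _).
  rewrite -prod_nat_const; apply: eq_bigr => x xA.
  by apply: eq_card => y; rewrite [LHS]/(_ ==> _) xA.
have -> : #|aT| - #|A| = #|~: A| by rewrite [RHS]cardsCs setCK.
rewrite -prod_nat_const.
apply: eq_big => [x|x xA]; first by rewrite inE.
by apply: eq_card => y; rewrite [LHS]/(_ ==> _) (negPf xA).
Qed.

Definition few_values (V C : finType) (k : nat) (B : {set V}) :
    {set {ffun V -> C}} := [set g : {ffun V -> C} | #|g @: B| < k].

(* Cover [few_values k B] by choosing a [k]-element list containing the image. *)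
Lemma card_few_values (V C : finType) (k : nat) (B : {set V}) :
  0 < #|C| ->
  #|@few_values V C k B| <= #|C| ^ k * k ^ #|B| * #|C| ^ (#|V| - #|B|).
Proof.
case/card_gt0P => c0 _.
pose img (K : {ffun 'I_k -> C}) := [set K i | i : 'I_k].
apply: (@leq_trans #|\bigcup_(K : {ffun 'I_k -> C})
    [set g : {ffun V -> C} | [forall x in B, g x \in img K]]|).
  apply: subset_leq_card; apply/subsetP => g; rewrite inE => gk.
  (* An image with fewer than [k] elements is padded to length [k] with [c0]. *)
  apply/bigcupP; exists [ffun i : 'I_k => nth c0 (enum (g @: B)) i] => //.
  rewrite inE; apply/forall_inP => x xB.
  have gx : g x \in enum (g @: B) by rewrite mem_enum imset_f.
  have ik : index (g x) (enum (g @: B)) < k.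
    by apply: leq_trans gk; rewrite ltnS cardE index_size.
  by apply/imsetP; exists (Ordinal ik); rewrite ?ffunE //= nth_index.
apply: leq_trans (leq_card_bigcup _ _) _.
have -> : #|C| ^ k = #|{ffun 'I_k -> C}| by rewrite card_ffun card_ord.
rewrite -mulnA -sum_nat_const; apply: leq_sum => K _.
rewrite card_ffun_in leq_mul2r leq_wexp2r ?orbT //.
by rewrite (leq_trans (leq_imset_card _ _)) // card_ord.
Qed.

(** Union bound in counting form: there are at most [#|V| ^ (h + n)] pairs [(A, B)], and for each
    pair the [h] rows indexed by [A] are chosen independently, each in at most as many ways as
    [card_few_values] allows. *)
Lemma exists_rows (V C : finType) (k h n : nat) :
  0 < #|C| ->
  #|V| ^ (h + n) * (#|C| ^ k * k ^ n * #|C| ^ (#|V| - n)) ^ h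
     < (#|C| ^ #|V|) ^ h ->
  exists H : {ffun V -> {ffun V -> C}}, forall A B : {set V},
    #|A| = h -> #|B| = n -> exists2 a, a \in A & k <= #|H a @: B|.
Proof.
set beta := (_ * _ * _)%N => C0 hlt.
have M0 : 0 < #|C| ^ #|V| by rewrite expn_gt0 C0.
pose bad (A B : {set V}) := [set H : {ffun V -> {ffun V -> C}} |
   [forall a in A, H a \in few_values C k B]].
pose X := \bigcup_(AB : {set V} * {set V} | (#|AB.1| == h) && (#|AB.2| == n))
   bad AB.1 AB.2.
have [/forallP Xall|] := boolP [forall H, H \in X]; last first.
  rewrite negb_forall => /existsP[H nX]; exists H => A B hA hB.
  apply/exists_inP; apply: contraNT nX; rewrite negb_exists_in => /forall_inP nX.
  apply/bigcupP; exists (A, B); first by rewrite hA hB !eqxx.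
  by rewrite inE; apply/forall_inP => a /nX; rewrite inE ltnNge.
exfalso.
have cX : (#|C| ^ #|V|) ^ #|V| <= #|X|.
  by rewrite -!card_ffun; apply: subset_leq_card; apply/subsetP => H _.
have hV : h <= #|V|.
  have : 0 < #|X| by apply: leq_trans cX; rewrite expn_gt0 M0.
  case/card_gt0P => H /bigcupP[[A B] /= /andP[/eqP <- _] _].
  exact: max_card.
have : #|X| <= #|V| ^ (h + n) * (beta ^ h * (#|C| ^ #|V|) ^ (#|V| - h)).
  apply: leq_trans (leq_card_bigcup _ _) _.
  apply: (@leq_trans (\sum_(AB : {set V} * {set V} |
      (#|AB.1| == h) && (#|AB.2| == n)) beta ^ h * (#|C| ^ #|V|) ^ (#|V| - h))).
    apply: leq_sum => -[A B] /= /andP[/eqP hA /eqP hB].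
    rewrite /bad card_ffun_in hA card_ffun leq_mul2r leq_wexp2r ?orbT //.
    by rewrite /beta -hB card_few_values.
  rewrite sum_nat_const leq_mul2r; apply/orP; right.
  have -> : #|[pred AB : {set V} * {set V} | (#|AB.1| == h) && (#|AB.2| == n)]|
    = #|setX [set A : {set V} | #|A| == h] [set B : {set V} | #|B| == n]|.
    by apply: eq_card => -[A B]; rewrite !inE.
  by rewrite cardsX !card_draws expnD leq_mul ?leq_bin_exp.
move=> /(leq_trans cX); rewrite -[X in _ ^ X <= _](subnKC hV) expnD mulnA.
rewrite leq_pmul2r ?expn_gt0 ?C0 // => /(leq_trans hlt).
by rewrite ltnn.
Qed.

(* With [q = 2 ^ (4 * u)], so [q ^ 3 = 2 ^ (12 * u)] colours, and the threshold
   [k = 4 * q ^ (5 / 2) = 4 * 2 ^ (10 * u)], a random function takes fewer than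
   [k] values on a given [n]-set with probability at most [2 ^ (- u * n)]. *)
Lemma few_values_exponent (u n N : nat) :
  4 <= u -> 96 * 2 ^ (10 * u) <= n -> n <= N ->
  (2 ^ (12 * u)) ^ (4 * 2 ^ (10 * u)) * (4 * 2 ^ (10 * u)) ^ n
    * (2 ^ (12 * u)) ^ (N - n) * 2 ^ (u * n) <= (2 ^ (12 * u)) ^ N.
Proof.
move=> hu hn hN.
have -> : 4 * 2 ^ (10 * u) = 2 ^ (2 + 10 * u) by rewrite expnD.
have {}hn : 24 * 2 ^ (2 + 10 * u) <= n by rewrite expnD mulnA.
rewrite -!expnM -!expnD leq_exp2l //.
move: (2 ^ (2 + 10 * u)) hn => k hn.
have h1 : 24 * k * u <= n * u by rewrite leq_mul2r hn orbT.
have h2 : 4 * n <= u * n by rewrite leq_mul2r hu orbT.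
have h3 : 12 * u * (N - n) = 12 * u * N - 12 * u * n by rewrite mulnBr.
have h4 : 12 * u * n <= 12 * u * N by rewrite leq_mul2l hN orbT.
by lia.
Qed.

(** For [h = uphalf n] a fixed pair is bad with probability at most [2 ^ (- u * n * h)], while
    [h + n <= 4 * h] bounds the number of pairs by [(#|V| ^ 4) ^ h]. *)
Lemma exists_rich_rows (C V : finType) (u n : nat) :
  #|C| = 2 ^ (12 * u) -> 4 <= u -> 96 * 2 ^ (10 * u) <= n ->
  #|V| ^ 4 < 2 ^ (u * n) ->
  exists H : {ffun V -> {ffun V -> C}}, forall A B : {set V},
    n <= 2 * #|A| -> #|B| = n ->
      exists2 a, a \in A & 4 * 2 ^ (10 * u) <= #|H a @: B|.
Proof.
move=> hC hu hn hV.
have C0 : 0 < #|C| by rewrite hC expn_gt0.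
have n0 : 0 < n by apply: leq_trans hn; rewrite muln_gt0 expn_gt0.
have [c0 _] := card_gt0P C0.
(* If [#|V| < n], no [B] has [n] elements and any [H] will do. *)
have [Vn|nV] := ltnP #|V| n.
  exists [ffun=> [ffun=> c0]] => A B _ hB.
  by have := max_card (mem B); rewrite hB leqNgt Vn.
have [|H hH] := @exists_rows V C (4 * 2 ^ (10 * u)) (uphalf n) n C0.
  have h0 : 0 < uphalf n by lia.
  have pos : 0 < 2 ^ (u * n) by rewrite expn_gt0.
  rewrite hC; have := few_values_exponent hu hn nV.
  have : 0 < (2 ^ (12 * u)) ^ (4 * 2 ^ (10 * u)) * (4 * 2 ^ (10 * u)) ^ n
      * (2 ^ (12 * u)) ^ (#|V| - n) by rewrite !(muln_gt0, expn_gt0).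
  move: (_ * _ ^ (_ - _)) (_ ^ #|V|) => b M b0 hb.
  apply: (@leq_trans ((b * 2 ^ (u * n)) ^ uphalf n)); last exact: leq_wexp2r.
  rewrite expnMn mulnC ltn_pmul2l ?expn_gt0 ?b0 //.
  apply: (@leq_ltn_trans ((#|V| ^ 4) ^ uphalf n)); last by rewrite ltn_exp2r.
  rewrite -expnM leq_pexp2l ?(leq_trans n0) //.
  by lia.
exists H => A B hA hB.
have /card_geqP[s [us ss sA]] : uphalf n <= #|A| by lia.
have [|a] := hH [set x in s] B _ hB; first by rewrite cardsE (card_uniqP us).
by rewrite inE => /sA aA ha; exists a.
Qed.

(** * Colouring by rows, and the edges of ordered copies *)

Definition row_colouring N (C : Type) (r : rel C) (H : 'I_N -> 'I_N -> C) :
    colouring N :=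
  [ffun e : {set 'I_N} => if [exists a : 'I_N, exists b : 'I_N, exists c : 'I_N,
     [&& a < b, b < c, e == [set a; b; c] & r (H a b) (H a c)]]
   then Blue else Red].

(** Ensures that the existential in [row_colouring] has at most one candidate. *)
Lemma ordered_triple_inj N (a b c a' b' c' : 'I_N) :
  a < b -> b < c -> a' < b' -> b' < c' ->
  [set a; b; c] = [set a'; b'; c'] -> [/\ a = a', b = b' & c = c'].
Proof.
move=> ab bc ab' bc' /setP e.
have m (x y z w : 'I_N) : (w \in [set x; y; z]) =
    [|| w == x :> nat, w == y :> nat | w == z :> nat].
  by rewrite !inE -orbA.
have := e a; have := e b; have := e c; have := e a'; have := e b'; have := e c'.
rewrite !m !eqxx /= ?orbT => h1 h2 h3 h4 h5 h6.
by split; apply: val_inj => /=; lia.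
Qed.

Lemma row_colouringE N (C : Type) (r : rel C) (H : 'I_N -> 'I_N -> C)
    (a b c : 'I_N) : a < b -> b < c ->
  row_colouring r H [set a; b; c] = if r (H a b) (H a c) then Blue else Red.
Proof.
move=> ab bc; rewrite ffunE; congr (if _ then _ else _).
apply/idP/idP => [|rH]; last first.
  apply/existsP; exists a; apply/existsP; exists b.
  by apply/existsP; exists c; apply/and4P.
case/existsP=> a' /existsP[b' /existsP[c' /and4P[ab' bc' /eqP e]]].
by have [-> -> ->] := ordered_triple_inj ab bc ab' bc' e.
Qed.

Lemma contains_copy_mono N (chi : colouring N) (b : colour) (H : ohgraph3) :
  contains_copy (colour_class chi b) H ->
  exists f : 'I_(nverts H) -> 'I_N,
    {homo f : i j / i < j} /\ forall i j k : 'I_(nverts H),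
      [set i; j; k] \in edges H -> chi [set f i; f j; f k] = b.
Proof.
case/existsP=> f /andP[/forallP hf /forall_inP he]; exists f; split.
  by move=> i j ij; have /forallP/(_ j)/implyP := hf i; apply.
move=> i j k /he; rewrite inE => /andP[_ /eqP <-].
by rewrite !imsetU !imset_set1.
Qed.

Lemma cards3_ord n (i j k : 'I_n) : i < j -> j < k -> #|[set i; j; k]| = 3.
Proof.
move=> ij jk; rewrite setUC cardsU1 cards2 !inE -!val_eqE /=.
by lia.
Qed.

Lemma card_part_interval n (k : 'I_3) : #|part_interval n k| = n.
Proof.
have lt (i : 'I_n) : k * n + i < 3 * n by have := ltn_ord i; have := ltn_ord k; nia.
have inj : injective (fun i : 'I_n => Ordinal (lt i)).
  by move=> i j [] /addnI/val_inj.
rewrite -[RHS]card_ord -(card_imset predT inj); apply: eq_card => v.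
rewrite inE; apply/andP/imsetP => [[h1 h2]|[i _ ->]] /=; last first.
  by rewrite leq_addr mulSn addnC ltn_add2r.
have vk : v - k * n < n by lia.
by exists (Ordinal vk) => //; apply: val_inj => /=; lia.
Qed.

Lemma tripartite3_edge n (x y z : 'I_(3 * n)) (k0 k1 k2 : 'I_3) :
  k0 = 0 :> nat -> k1 = 1 :> nat -> k2 = 2 :> nat ->
  x \in part_interval n k0 -> y \in part_interval n k1 ->
  z \in part_interval n k2 ->
  [/\ x < y, y < z & [set x; y; z] \in edges (tripartite3 n)].
Proof.
rewrite !inE => -> -> -> hx hy hz.
have xy : x < y by lia.
have yz : y < z by lia.
split; rewrite // cards3_ord //=; apply/forallP => k.
have key w : w \in [set x; y; z] ->
   (forall w', w' \in [set x; y; z] -> (w' \in part_interval n k) = (w' == w)) ->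
   #|[set x; y; z] :&: part_interval n k| == 1.
  move=> hw h; apply/cards1P; exists w; apply/setP => w'; rewrite in_setI in_set1.
  case: (boolP (w' \in [set x; y; z])) => [/h ->|nw'] //.
  by have /negbTE -> : w' != w by apply: contraNneq nw' => ->.
case: k key => [[|[|[|//]]]] hk key.
- by apply: (key x) => [|w]; rewrite !inE ?eqxx ?orbT // -!val_eqE /=; lia.
- by apply: (key y) => [|w]; rewrite !inE ?eqxx ?orbT // -!val_eqE /=; lia.
- by apply: (key z) => [|w]; rewrite !inE ?eqxx ?orbT // -!val_eqE /=; lia.
Qed.

(** * Flags of the affine plane *)

Local Open Scope ring_scope.

(* [(x, s, b)] is the flag made of the line [y = s * x + b] and its point of
   abscissa [x]. *)
Definition on_line (F : finFieldType) (v : F * F * F) (p : F * F) : bool :=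
  p.2 == v.1.2 * p.1 + v.2.

Definition flag_point (F : finFieldType) (v : F * F * F) : F * F :=
  (v.1.1, v.1.2 * v.1.1 + v.2).

Definition flag_arc (F : finFieldType) (v w : F * F * F) : bool :=
  [&& v.1.2 != w.1.2, v.1.1 != w.1.1 & on_line v (flag_point w)].

(** The points of [v] and [w] would both lie on the lines of [u] and [v]. These lines have different
    slopes, so the points would coincide, but their abscissas differ. *)
Lemma flag_arc_no_transitive_triangle (F : finFieldType) (u v w : F * F * F) :
  flag_arc u v -> flag_arc u w -> flag_arc v w -> False.
Proof.
case: u v w => [[x1 s1] b1] [[x2 s2] b2] [[x3 s3] b3].
rewrite /flag_arc /on_line /=.
case/and3P=> s12 _ /eqP e12 /and3P[_ _ /eqP e13] /and3P[_ x23 /eqP e23].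
have : (s1 - s2) * (x2 - x3) = 0.
  have -> : (s1 - s2) * (x2 - x3) =
    (s1 * x2 + b1 - (s2 * x2 + b2)) - (s1 * x3 + b1 - (s2 * x3 + b2)) by ring.
  by rewrite -e12 -e13 -e23 !subrr.
by apply/eqP; rewrite mulf_neq0 // subr_eq0.
Qed.

(** * Arcs between large sets of flags, by second moment *)

Section Expansion.
Variable F : finFieldType.
Local Notation q := #|F|.
Local Notation flag := (F * F * F)%type.

Lemma card_line (v : flag) : #|[set p | on_line v p]| = q.
Proof.
have inj : injective (fun x : F => (x, v.1.2 * x + v.2)) by move=> x y [].
rewrite -(card_imset predT inj); apply: eq_card => -[x y]; rewrite inE /on_line /=.
by apply/eqP/imsetP => [-> | [z _ [-> ->]] //]; exists x.
Qed.

(** Distinct lines meet at most once, and equal lines share [q] points; one formula covers both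
    cases, ready for summation over flags. *)
Lemma card_lineI (v w : flag) :
  (#|[set p | on_line v p && on_line w p]|
     <= 1 + q * ((v.1.2 == w.1.2) && (v.2 == w.2)))%N.
Proof.
have [/andP[/eqP s /eqP b]|ne] := boolP (_ && _).
  rewrite muln1 (leq_trans _ (leq_addl _ _)) // -(card_line v).
  by apply: subset_leq_card; apply/subsetP => p; rewrite !inE => /andP[].
rewrite muln0 addn0; apply/card_le1_eqP => -[x1 y1] [x2 y2].
rewrite !inE /on_line /= => /andP[/eqP h1 /eqP h2] /andP[/eqP h3 /eqP h4].
have E : (v.1.2 - w.1.2) * (x1 - x2) = 0.
  have -> : (v.1.2 - w.1.2) * (x1 - x2) =
    (v.1.2 * x1 + v.2) - (w.1.2 * x1 + w.2)
    - ((v.1.2 * x2 + v.2) - (w.1.2 * x2 + w.2)) by ring.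
  by rewrite -h1 -h2 -h3 -h4; ring.
move/eqP: E; rewrite mulf_eq0 !subr_eq0 => /orP[/eqP s|/eqP x12]; last first.
  by rewrite h1 h3 x12.
case/negP: ne; rewrite s eqxx /=; apply/eqP.
by apply: (@addrI _ (w.1.2 * x1)); rewrite -h2 h1 s.
Qed.

Lemma card_flags_on_line (v : flag) :
  #|[set w : flag | (v.1.2 == w.1.2) && (v.2 == w.2)]| = q.
Proof.
have inj : injective (fun x : F => (x, v.1.2, v.2)) by move=> x y [].
rewrite -(card_imset predT inj); apply: eq_card => -[[x s] b]; rewrite inE /=.
apply/idP/imsetP => [/andP[/eqP<- /eqP<-]|[z _ [_ -> ->]]]; first by exists x.
by rewrite !eqxx.
Qed.

Lemma card_flags_at_point (p : F * F) :
  #|[set w : flag | flag_point w == p]| = q.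
Proof.
have inj : injective (fun s : F => (p.1, s, p.2 - s * p.1)) by move=> x y [].
rewrite -(card_imset predT inj); apply: eq_card => -[[x s] b]; rewrite inE /=.
case: p {inj} => p1 p2; apply/eqP/imsetP => [[<- <-]|[z _ [-> -> ->]] /=].
  by exists s => //=; rewrite addrAC subrr add0r.
by rewrite /flag_point /= addrC subrK.
Qed.

(** A line counts once for each of its flags in [S], so up to [q] times. *)
Definition degree (S : {set flag}) (p : F * F) : nat :=
  #|[set v in S | on_line v p]|.

Lemma degreeE S p : degree S p = (\sum_(v in S) on_line v p)%N.
Proof.
rewrite /degree -sum1_card big_mkcond [RHS]big_mkcond; apply: eq_bigr => v _.
by rewrite inE; case: (v \in S); case: (on_line v p).
Qed.

Lemma sum_degree (S : {set flag}) : (\sum_p degree S p = q * #|S|)%N.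
Proof.
rewrite (eq_bigr _ (fun p _ => degreeE S p)) exchange_big /=.
rewrite (eq_bigr (fun _ => q)) ?sum_nat_const 1?mulnC // => v _.
rewrite -[RHS](card_line v) -sum1_card big_mkcond [RHS]big_mkcond.
by apply: eq_bigr => p _; rewrite inE; case: on_line.
Qed.

(** The left side counts pairs of flags with a common point of their lines. Each [v] shares its line
    with at most [q] flags [w], which gives the excess [q * q] per [v]. *)
Lemma sum_degree_sqr (S : {set flag}) :
  (\sum_p degree S p ^ 2 <= #|S| ^ 2 + q ^ 2 * #|S|)%N.
Proof.
have -> : (\sum_p degree S p ^ 2 = \sum_(v in S) \sum_(w in S)
            #|[set p | on_line v p && on_line w p]|)%N.
  under eq_bigr => p _ do rewrite degreeE -mulnn big_distrl /=.
  rewrite exchange_big; apply: eq_bigr => v _ /=.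
  under eq_bigr => p _ do rewrite big_distrr /=.
  rewrite exchange_big; apply: eq_bigr => w _ /=.
  rewrite -sum1_card [RHS]big_mkcond; apply: eq_bigr => p _ /=.
  by rewrite inE; case: on_line; case: on_line.
have -> : (#|S| ^ 2 + q ^ 2 * #|S| = \sum_(v in S) (#|S| + q * q))%N.
  by rewrite sum_nat_const mulnn; lia.
apply: leq_sum => v _; apply: (@leq_trans (\sum_(w in S)
    (1 + q * ((v.1.2 == w.1.2) && (v.2 == w.2))))).
  by apply: leq_sum => w _; apply: card_lineI.
rewrite big_split /= sum1_card leq_add2l -big_distrr leq_mul2l /=.
apply/orP; right; rewrite -[leqRHS](card_flags_on_line v) -sum1_card.
rewrite big_mkcond [leqRHS]big_mkcond /=; apply: leq_sum => w _.
by rewrite inE; case: (w \in S); case: (_ && _).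
Qed.

(** The mean degree over the [q ^ 2] points is [#|S| / q]; multiplying by [q] keeps the deviations
    integral. *)
Lemma variance_degree (S : {set flag}) :
  \sum_p ((q * degree S p)%:Z - #|S|%:Z) ^+ 2 <= (q ^ 4 * #|S|)%:Z.
Proof.
have -> : \sum_p ((q * degree S p)%:Z - #|S|%:Z) ^+ 2 =
  (q ^ 2)%:Z * (\sum_p degree S p ^ 2)%N%:Z
  - (2 * q * #|S|)%:Z * (\sum_p degree S p)%N%:Z + (q ^ 2 * #|S| ^ 2)%:Z.
  rewrite -!natz !natr_sum !mulr_sumr -sumrB.
  have -> : (q ^ 2 * #|S| ^ 2)%:R = \sum_(p : F * F) (#|S| ^ 2)%:R :> int.
    by rewrite sumr_const card_prod -mulrnA [in RHS]mulnC mulnn.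
  rewrite -big_split /=; apply: eq_bigr => p _.
  by rewrite !natz; lia.
rewrite sum_degree; have := sum_degree_sqr S; move: (\sum_p _)%N => d.
by move=> /(leq_mul (leqnn (q ^ 2))); nia.
Qed.

(** Chebyshev: at such a point [q * degree S p <= 2 * q ^ 2 <= #|S| / 2], so its term in
    [variance_degree] is at least [#|S| ^ 2 / 4]. *)
Lemma card_low_degree (S : {set flag}) :
  (4 * q ^ 2 <= #|S|)%N ->
  (#|[set p | degree S p <= 2 * q]%N| * #|S| <= 4 * q ^ 4)%N.
Proof.
move=> hS; have [->|S0] := posnP #|S|; first by rewrite muln0.
rewrite -(leq_pmul2r S0) -mulnA mulnn.
have := variance_degree S.
rewrite (bigID (fun p => degree S p <= 2 * q)%N) /= => hv.
suff : (#|[set p | degree S p <= 2 * q]%N| * #|S| ^ 2)%:Z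
   <= 4 * \sum_(p | (degree S p <= 2 * q)%N)
       ((q * degree S p)%:Z - #|S|%:Z) ^+ 2.
  have aux (a b : int) (x y : nat) :
      a + b <= x%:Z -> 0 <= b -> y%:Z <= 4 * a -> (y <= 4 * x)%N by lia.
  move=> h; rewrite -mulnA; apply: aux hv _ h.
  by apply: sumr_ge0 => p _; apply: sqr_ge0.
rewrite mulr_sumr -sum1dep_card big_distrl /= -natz natr_sum.
apply: ler_sum => p hp; rewrite mul1n natz.
have : (q * degree S p <= 2 * q ^ 2)%N.
  by have := leq_mul (leqnn q) hp; rewrite mulnCA mulnn.
move: hS; move: (q * degree S p)%N (#|S|) (q ^ 2)%N => e s r h1 h2.
have : (2 * e <= s)%N by lia.
by move=> {}h1; rewrite expr2 -mulnn; nia.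
Qed.

Lemma exists_flag_arc (S T : {set flag}) :
  (4 * q ^ 2 <= #|S|)%N -> (4 * q ^ 5 < #|S| * #|T|)%N ->
  exists v w, [/\ v \in S, w \in T & flag_arc v w].
Proof.
move=> hS hT.
(* Otherwise all flags of [T] sit at low-degree points, [q] flags per point, and [card_low_degree]
   gives [#|S| * #|T| <= 4 * q ^ 5]. *)
have [w wT hw] : exists2 w, w \in T & (2 * q < degree S (flag_point w))%N.
  apply/exists_inP; apply: contraTT hT; rewrite negb_exists_in -leqNgt.
  move=> /forall_inP hT.
  have : (#|T| <= #|[set p | degree S p <= 2 * q]%N| * q)%N.
    rewrite -sum_nat_const -sum1_card.
    rewrite (partition_big (@flag_point F)
      [in [set p | degree S p <= 2 * q]%N]) /=; last first.
      by move=> w /hT; rewrite inE -leqNgt.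
    apply: leq_sum => p _; rewrite -[leqRHS](card_flags_at_point p) -sum1_card.
    rewrite big_mkcond [leqRHS]big_mkcond /=; apply: leq_sum => w _.
    by rewrite inE; case: (w \in T).
  by have := card_low_degree hS; nia.
(* Of the flags whose line contains the point of [w], at most [q] have the slope
   of [w], and at most [q] its abscissa. *)
suff : exists2 v, v \in [set v in S | on_line v (flag_point w)]
   & (v.1.2 != w.1.2) && (v.1.1 != w.1.1).
  case=> v; rewrite inE => /andP[vS vw] /andP[h1 h2].
  by exists v, w; split => //; apply/and3P.
apply/exists_inP; apply: contraLR hw; rewrite negb_exists_in -leqNgt.
move=> /forall_inP hall; rewrite /degree.
pose p := flag_point w.
pose s1 := [set (x, w.1.2, p.2 - w.1.2 * p.1) | x : F].
pose s2 := [set (w.1.1, s, p.2 - s * p.1) | s : F].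
apply: leq_trans (subset_leq_card (_ : _ \subset s1 :|: s2)) _.
  apply/subsetP => -[[x s] b] hv; have := hall _ hv.
  move: hv; rewrite inE /on_line /= => /andP[_ /eqP e].
  have eb : b = p.2 - s * p.1 by rewrite /p /= e addrC addKr.
  rewrite negb_and !negbK eb !inE => /orP[] /eqP->; apply/orP; [left|right].
    by apply/imsetP; exists x.
  by apply/imsetP; exists s.
apply: leq_trans (leq_card_setU _ _) _; rewrite mul2n -addnn.
by apply: leq_add; apply: leq_imset_card.
Qed.
End Expansion.

(** * The Ramsey bound in powers of two *)

Lemma arrows_pow_bound (t u n N : nat) :
  (3 <= t)%N -> (4 <= u)%N -> (96 * 2 ^ (10 * u) <= n)%N ->
  arrows N (complete3 t.+1) (tripartite3 n) -> (2 ^ (u * n) <= N ^ 4)%N.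
Proof.
move=> ht hu hn; apply: contraLR; rewrite -ltnNge => hN.
have u4 : (0 < 4 * u)%N by rewrite muln_gt0 (leq_trans _ hu).
have [F _ hF] := pPrimePowerField (isT : prime 2) u4.
have hC : #|((F * F * F)%type : finType)| = (2 ^ (12 * u))%N.
  by rewrite !card_prod hF -!expnD; congr (2 ^ _)%N; lia.
have [|H hH] := exists_rich_rows (V := 'I_N) hC hu hn; first by rewrite card_ord.
pose chi := row_colouring (@flag_arc F) (fun a b : 'I_N => H a b).
apply/negP => /forallP/(_ chi)/orP[] /contains_copy_mono[f [fmono fchi]].
(* In a blue copy, the flags of the pairs 01, 02, 03 among its first four vertices form a transitive
   triangle. *)
- have v (i : nat) (hi : (i < 4)%N) : (i < t.+1)%N by apply: leq_trans hi _.
  pose w i hi : 'I_t.+1 := Ordinal (v i hi).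
  have blue i j k (hi : (i < 4)%N) (hj : (j < 4)%N) (hk : (k < 4)%N) :
      (i < j < k)%N ->
      flag_arc (H (f (w i hi)) (f (w j hj))) (H (f (w i hi)) (f (w k hk))).
    move=> /andP[ij jk].
    have := fchi (w i hi) (w j hj) (w k hk).
    rewrite inE cards3_ord // => /(_ isT).
    by rewrite row_colouringE; [case: flag_arc | apply: fmono..].
  exact: (flag_arc_no_transitive_triangle
    (blue 0 1 2 isT isT isT isT)%N (blue 0 1 3 isT isT isT isT)%N
    (blue 0 2 3 isT isT isT isT)%N).
- have f_inj : injective f.
    move=> i j fij; apply: val_inj; have [/fmono|/fmono|//] := ltngtP i j;
      by rewrite fij ltnn.
  pose k0 : 'I_3 := Ordinal (isT : (0 < 3)%N).
  pose k1 : 'I_3 := Ordinal (isT : (1 < 3)%N).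
  pose k2 : 'I_3 := Ordinal (isT : (2 < 3)%N).
  pose part k : {set 'I_N} := f @: part_interval n k.
  have part_card k : #|part k| = n by rewrite card_imset ?card_part_interval.
  pose rich k := [set a | (4 * 2 ^ (10 * u) <= #|H a @: part k|)%N].
  (* The poor vertices contain no rich row, so they number less than [n / 2] for each of the two
     parts; hence some vertex of the first part is rich for both. *)
  have no_poor k : (2 * #|part k0 :\: rich k| < n)%N.
    rewrite ltnNge; apply/negP => /hH/(_ (part_card k))[a].
    by rewrite !inE => /andP[/negbTE->].
  have [a aP [a1 a2]] : exists2 a, a \in part k0 & a \in rich k1 /\ a \in rich k2.
    have : (0 < #|part k0 :&: (rich k1 :&: rich k2)|)%N.
      have := cardsID (rich k1 :&: rich k2) (part k0).
      rewrite part_card setDIr.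
      have /leq_of_leqif := leq_card_setU (part k0 :\: rich k1) (part k0 :\: rich k2).
      by have := no_poor k1; have := no_poor k2; lia.
    by case/card_gt0P => a; rewrite 2!in_setI => /and3P[? ? ?]; exists a.
  move: a1 a2; rewrite !inE => a1 a2.
  have [||v [w [/imsetP[_ /imsetP[y yP ->] ->] /imsetP[_ /imsetP[z zP ->] ->]]]] :=
      @exists_flag_arc F (H a @: part k1) (H a @: part k2).
  (* With [q = 2 ^ (4 * u)], the two conditions are [4 * 2 ^ (8 * u) <= 4 * 2 ^ (10 * u)] and
     [4 * 2 ^ (20 * u) < 16 * 2 ^ (20 * u)]. *)
  + rewrite hF -expnM; apply: leq_trans a1.
    by rewrite leq_mul2l /= leq_exp2l //; lia.
  + apply: leq_trans (leq_mul a1 a2); rewrite mulnACA -expnD hF -expnM.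
    have -> : (4 * u * 5 = 10 * u + 10 * u)%N by lia.
    by rewrite ltn_pmul2r // expn_gt0.
  case/imsetP: aP yP zP => x xP -> yP zP.
  have [xy yz e] := tripartite3_edge (erefl : k0 = 0 :> nat)%N
    (erefl : k1 = 1 :> nat)%N (erefl : k2 = 2 :> nat)%N xP yP zP.
  have := fchi _ _ _ e.
  by rewrite row_colouringE; [case: flag_arc | apply: fmono..].
Qed.

(** * Choice of scale and of the constant *)

(** Settles bounded [n]. Any colouring serves, since either copy has at least two vertices. *)
Lemma arrows_gt1 (t n N : nat) :
  (3 <= t)%N -> (0 < n)%N ->
  arrows N (complete3 t.+1) (tripartite3 n) -> (1 < N)%N.
Proof.
move=> ht hn /forallP/(_ [ffun=> Blue])/orP[] /contains_copy_mono[f [fmono _]].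
- have h1 : (1 < t.+1)%N by lia.
  by have /leq_ltn_trans/(_ (ltn_ord _)) := fmono ord0 (Ordinal h1) isT; lia.
- have h0 : (0 < 3 * n)%N by lia.
  have h1 : (1 < 3 * n)%N by lia.
  by have /leq_ltn_trans/(_ (ltn_ord _)) := fmono (Ordinal h0) (Ordinal h1) isT; lia.
Qed.

Lemma size_scale (n : nat) : (0 < n)%N ->
  (n < 2 ^ 47)%N \/
  exists u : nat, [/\ (4 <= u)%N, (96 * 2 ^ (10 * u) <= n)%N
                    & (n <= 2 ^ (15 * u))%N].
Proof.
move=> n0; have := trunc_logP (isT : 1 < 2)%N n0.
have := trunc_log_ltn n (isT : 1 < 2)%N; move: (trunc_log 2 n) => l ltn_l le_l.
have [hl|hl] := ltnP l 47; [left | right].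
  by apply: leq_trans ltn_l _; rewrite leq_exp2l.
(* The 7 comes from [96 <= 2 ^ 7]. Since [l <= 10 * u + 16] and [4 <= u], also [l + 1 <= 15 * u]. *)
exists ((l - 7) %/ 10)%N.
have := divn_eq (l - 7) 10; have := ltn_pmod (l - 7) (isT : 0 < 10)%N.
move: (_ %/ _)%N (_ %% _)%N => u r hr hu; split; first by lia.
  apply: leq_trans le_l; apply: (@leq_trans (2 ^ (7 + 10 * u))%N).
    by rewrite expnD leq_mul2r orbT.
  by rewrite leq_exp2l //; lia.
by apply: leq_trans (ltnW ltn_l) _; rewrite leq_exp2l //; lia.
Qed.

Lemma ler_ln_nat (R : realType) (m n : nat) :
  (0 < m)%N -> (m <= n)%N -> ln m%:R <= ln n%:R :> R.
Proof.
by move=> m0 mn; rewrite ler_ln ?posrE ?ltr0n ?ler_nat // (leq_trans m0).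
Qed.

Lemma ln_natX (R : realType) (m k : nat) :
  (0 < m)%N -> ln (m ^ k)%N%:R = k%:R * ln m%:R :> R.
Proof. by move=> m0; rewrite natrX lnXn ?ltr0n // mulr_natl. Qed.

Lemma ln_le_exponent (R : realType) (n e : nat) :
  (0 < n)%N -> (n <= 2 ^ e)%N -> ln n%:R <= e%:R * ln 2 :> R.
Proof. by move=> n0 ne; rewrite -(ln_natX _ e) // ler_ln_nat. Qed.

Lemma natr_le_exponent (R : realType) (n e : nat) :
  (n <= 2 ^ e)%N -> n%:R <= 2 ^+ e :> R.
Proof. by rewrite -natrX ler_nat. Qed.

Unset Implicit Arguments.

Theorem theorem2 (R : realType) (t : nat) (ht : (3 <= t)%N) :
  exists c : R, 0 < c /\
    forall n : nat, (0 < n)%N ->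
      2 `^ (c * n%:R * log2 n%:R)
        <= (ordered_ramsey (complete3 t.+1) (tripartite3 n))%:R.
Proof.
(* [K] hides the literal [2 ^ 47], which [lra] would expand. *)
have [K [K1 hK]] : exists K : R, 1 <= K /\
    forall n : nat, (n < 2 ^ 47)%N -> n%:R <= K.
  exists (2 ^+ 47); split; first by rewrite exprn_ege1 // ler1n.
  by move=> n /ltnW; exact: natr_le_exponent.
have K0 : 0 < K by exact: lt_le_trans K1.
(* It remains to bound [n * ln n] by [64 * K * ln N]. Small [n] give at most [47 * K * ln 2], and
   large [n] at most [15 * u * n * ln 2 <= 60 * ln N]. *)
exists (K * 64)^-1; split=> [|n n0]; first by rewrite invr_gt0 mulr_gt0.
rewrite /ordered_ramsey; case: ex_minnP => N arr _.
have N1 := arrows_gt1 ht n0 arr.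
have l2 : 0 < ln 2 :> R by rewrite ln_gt0 // ltr1n.
rewrite /powR pnatr_eq0 /= -[leRHS]lnK ?posrE ?ltr0n 1?ltnW // ler_expR /log2.
rewrite mulrA divfK ?gt_eqF // -mulrA mulrC ler_pdivrMr ?mulr_gt0 //.
have [small | [u [u4 un nu]]] := size_scale n0.
- have nn := hK n small.
  have ln_n : ln n%:R <= 47 * ln 2 :> R
    by exact: ln_le_exponent _ n0 (ltnW small).
  have lnN : ln 2 <= ln N%:R :> R by exact: ler_ln_nat.
  apply: (@le_trans _ _ (K * (47 * ln 2))).
    by apply: ler_pM nn ln_n; rewrite ?ler0n ?ln_ge0 ?ler1n.
  clear small hK; by rewrite [leRHS]mulrCA ler_pM2l //; lra.
- have ln_n : ln n%:R <= 15 * u%:R * ln 2 :> R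
    by rewrite -natrM; exact: ln_le_exponent.
  have lnN : u%:R * n%:R * ln 2 <= 4 * ln N%:R :> R.
    rewrite -natrM -!ln_natX 1?ltnW // ler_ln_nat ?expn_gt0 //.
    exact: arrows_pow_bound arr.
  have N0 : 0 <= ln N%:R :> R by rewrite ln_ge0 // ler1n ltnW.
  have := ler_wpM2l (ler0n R n) ln_n.
  have := ler_wpM2l N0 K1.
  by lra.
Qed.
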